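(* Let $I=[a,b]$ be a compact interval, let $(X,d)$ be a complete metric space, let $g:I\to\mathbb R$ be left-continuous and nondecreasing, let $\alpha>1$, and let $F:I\to\mathcal K(X)$ be $g$-Hölder of exponent $\alpha$. Fix $\theta\in I$ and $x_\theta\in F(\theta)$, and let $f:I\to X$ be a selection of $F$ with $f(\theta)=x_\theta$ such that, for every $a\le s<t\le b$, $$d(f(s),f(t))\le V_H(F;[s,t])\le[F]_{\alpha,g}|g(t)-g(s)|^\alpha\quad\text{and}\quad V(f;[s,t])\le V_H(F;[s,t]).$$ Then, for every $a\le s<t\le b$, $$V(f;[s,t])=\sum_{\tau\in[s,t)}J_f(\tau)=\sum_{\tau\in[s,t)}d(f(\tau+),f(\tau)).$$
   Context: $\mathcal K(X)$ is the family of all nonempty compact subsets of $X$ with Hausdorff distance $d_H$. A selection of $F$ is a map $f:I\to X$ with $f(t)\in F(t)$ for all $t\in I$. $F$ is $g$-Hölder of exponent $\alpha$ if there is $L\ge0$ with $d_H(F(s),F(t))\le L|g(t)-g(s)|^\alpha$ for all $s,t\in I$; $[F]_{\alpha,g}$ is the minimum such $L$. $V_H(F;[s,t])=\sup_P\sum_{i=1}^n d_H(F(t_{i-1}),F(t_i))$ and $V(f;[s,t])=\sup_P\sum_{i=1}^n d(f(t_{i-1}),f(t_i))$ over all finite partitions $P:s=t_0<\cdots<t_n=t$. For $\tau\in[a,b)$, $f(\tau+)=\lim_{r\downarrow\tau}f(r)$ in $X$ (under the stated hypotheses this limit exists for every $\tau\in[a,b)$), and $J_f(\tau)=d(f(\tau+),f(\tau))$.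 *)

(* Defs.v *)
From HB Require Import structures.
From mathcomp Require Import all_boot all_order all_algebra.
From mathcomp Require Import all_classical all_reals all_analysis.
Set Implicit Arguments.
Unset Strict Implicit.
Unset Printing Implicit Defensive.
Import Order.TTheory GRing.Theory Num.Theory.
Import numFieldNormedType.Exports.
Local Open Scope classical_set_scope.
Local Open Scope ring_scope.

(* Completeness in the library comes with a distinguished point, i.e. the
   space is nonempty. *)
#[short(type="completeMetricType")]
HB.structure Definition CompleteMetric (R : numDomainType) :=
  {T of Metric R T & Complete T}.

Section hausdorff.
Context {R : realType} {X : metricType R}.
Implicit Types A B : set X.

Definition nonempty_compacts : set (set X) :=
  [set A | A !=set0 /\ compact A].

Definition dist_to_set (x : X) A : R := inf [set mdist x y | y in A].

(* The suprema are genuine as soon as A and B are nonempty and bounded, in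
   particular on nonempty_compacts. *)
Definition hausdorff_dist A B : R :=
  Num.max (sup [set dist_to_set x B | x in A])
          (sup [set dist_to_set y A | y in B]).

End hausdorff.

Section variation.
Context {R : realType} {T : Type}.

(* Generic in the distance delta, so as to cover both points of X (mdist) and
   subsets of X (hausdorff_dist). As in itv_partition, s :: p is the list of
   the partition points. *)
Definition variation_on (delta : T -> T -> R) (h : R -> T) (s t : R)
    (p : seq R) : R :=
  let u := h \o nth t (s :: p) in
  \sum_(0 <= n < size p) delta (u n) (u n.+1).

Definition variation_sup (delta : T -> T -> R) (h : R -> T) (s t : R)
    : \bar R :=
  ereal_sup [set (variation_on delta h s t p)%:E | p in itv_partition s t].

End variation.

Definition metric_variation {R : realType} {X : metricType R} (f : R -> X) :=
  variation_sup mdist f.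

Definition hausdorff_variation {R : realType} {X : metricType R}
    (F : R -> set X) := variation_sup hausdorff_dist F.

Section holder.
Context {R : realType} {X : metricType R}.
Variables (a b : R) (g : R -> R) (alpha : R) (F : R -> set X).

Definition holder_const (L : R) : Prop :=
  0 <= L /\ {in `[a, b] &, forall s t,
    hausdorff_dist (F s) (F t) <= L * `|g t - g s| `^ alpha}.

Definition is_holder : Prop := exists L, holder_const L.

Definition holder_seminorm : R := inf [set L | holder_const L].

(* The infimum is a minimum. *)
Lemma holder_seminorm_min : is_holder ->
  holder_const holder_seminorm /\
  forall L, holder_const L -> holder_seminorm <= L.
Proof.
move=> [L0 hL0].
have lb : has_lbound [set L | holder_const L] by exists 0 => L [].
have ne : [set L | holder_const L] !=set0 by exists L0.
split; last by move=> L hL; exact: ge_inf.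
split; first by apply: lb_le_inf => // L [].
move=> s t sI tI.
have := powR_ge0 `|g t - g s| alpha; rewrite le_eqVlt => /predU1P[c0|c_gt0].
  by rewrite -c0 mulr0 -(mulr0 L0) c0; exact: hL0.2.
rewrite -ler_pdivrMr//; apply: lb_le_inf => // L [_ hL].
by rewrite ler_pdivrMr//; exact: hL.
Qed.

End holder.

Section jumps.
Context {R : realType} {X : completeMetricType R}.

Definition right_limit (f : R -> X) (tau : R) : X := lim (f x @[x --> tau^'+]).

Definition jump (f : R -> X) (tau : R) : R :=
  mdist (right_limit f tau) (f tau).

End jumps.

(* Main.v *)
(** Since [alpha > 1], the Hölder bound makes [d(f(s), f(t))] at most
    [eps * (g(t) - g(s))] as soon as [g(t) - g(s)] is small. As [g] is
    left-continuous and nondecreasing, its increments are small just to the left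
    of every point, and just to the right of every point [u] when measured from
    [g(u+)]. Walking from [s] to [t], the right limit of [f] is therefore the
    only place where [f] moves by more than [eps] times the increment of [g], so
    that [d(f(s), f(t))] is at most the sum of the jumps over [[s, t)] plus
    [eps * (g(t) - g(s))]. Letting [eps] tend to 0 and summing along a partition
    bounds the variation by the sum of the jumps. Conversely, finitely many jumps
    are limits of the distances [d(f(tau), f(r))], [r] decreasing to [tau], over
    disjoint intervals. *)
Require Import Defs.
From mathcomp Require Import all_boot all_order all_algebra.
From mathcomp Require Import all_classical all_reals all_analysis.
From mathcomp Require Import lra.
Import Order.TTheory GRing.Theory Num.Theory.
Import numFieldNormedType.Exports.
Local Open Scope classical_set_scope.
Local Open Scope ring_scope.

(** * Variation and its left endpoint *)

Section variation_theory.
Context {R : realType} {X : metricType R} (f : R -> X).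
Implicit Types (s r t : R) (p : seq R).

Lemma variation_on_cons s t x p :
  variation_on mdist f s t (x :: p) =
  mdist (f s) (f x) + variation_on mdist f x t p.
Proof. by rewrite /variation_on /= big_nat_recl. Qed.

Lemma metric_variation_ge0 s t : s <= t -> (0 <= metric_variation f s t)%E.
Proof.
move=> st; have [p sptp] : exists p, itv_partition s t p.
  move: st; rewrite le_eqVlt => /predU1P[->|st]; first by exists [::].
  by exists [:: t]; exact: itv_partition1.
apply: ereal_sup_ge; exists (variation_on mdist f s t p)%:E; first by exists p.
by rewrite lee_fin sumr_ge0// => i _; exact: mdist_ge0.
Qed.

(** Prepending [r] to a partition of [[r, t]] gives a partition of [[s, t]]. *)
Lemma mdist_metric_variation s r t : s < r ->
  ((mdist (f s) (f r))%:E + metric_variation f r t <= metric_variation f s t)%E.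
Proof.
move=> sr; rewrite -leeBrDl//; apply: ge_ereal_sup => _ [p [rp lp] <-].
rewrite leeBrDl// -EFinD -variation_on_cons.
by apply: ereal_sup_ubound; exists (r :: p) => //; split => //=; rewrite sr.
Qed.

Lemma le_metric_variation s r t : s <= r ->
  (metric_variation f r t <= metric_variation f s t)%E.
Proof.
rewrite le_eqVlt => /predU1P[->//|sr].
apply: (le_trans _ (mdist_metric_variation s r t sr)).
by rewrite leeDr// lee_fin mdist_ge0.
Qed.

End variation_theory.

(** * Sums of nonnegative terms over half-open intervals *)

Section half_open_sums.
Context {R : realType} (h : R -> \bar R).
Hypothesis h_ge0 : forall x, (0 <= h x)%E.
Implicit Types s r t : R.

Lemma esum_itv_split s r t : s <= r -> r <= t ->
  (\esum_(x in `[s, t[) h x =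
   \esum_(x in `[s, r[) h x + \esum_(x in `[r, t[) h x)%E.
Proof.
move=> sr rt; rewrite (esumID `[s, r[%classic)//; congr (_ + _)%E.
  congr esum; apply/seteqP; split => x /=; rewrite !in_itv/=; first by case.
  by move=> /andP[sx xr]; rewrite sx xr (lt_le_trans xr).
congr esum; apply/seteqP; split => x /=; rewrite !in_itv/=.
  by move=> [/andP[sx ->]] /negP; rewrite sx/= -leNgt => ->.
move=> /andP[rx xt]; rewrite (le_trans sr)// xt; split => //.
by rewrite ltNge rx andbF.
Qed.

Lemma esum_itv_ge r t : r < t -> (h r <= \esum_(x in `[r, t[) h x)%E.
Proof.
move=> rt; apply: esum_ge; exists [set r]; last by rewrite fsbig_set1.
by split=> [|_ ->]; [exact: finite_set1|rewrite /= in_itv/= lexx].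
Qed.

Lemma le_esum_itv s r t : s <= r -> r <= t ->
  (\esum_(x in `[s, r[) h x <= \esum_(x in `[s, t[) h x)%E.
Proof.
by move=> sr rt; rewrite (esum_itv_split s r t sr rt) leeDl// esum_ge0.
Qed.

(** Sums over half-open intervals are additive, so the bounds on the pieces of a partition add up to
    the sum over [[s, t[]. *)
Lemma metric_variation_le_esum {X : metricType R} (f : R -> X) s t :
  (forall u v, s <= u -> u < v -> v <= t ->
    ((mdist (f u) (f v))%:E <= \esum_(x in `[u, v[) h x)%E) ->
  (metric_variation f s t <= \esum_(x in `[s, t[) h x)%E.
Proof.
move=> fh; apply: ge_ereal_sup => _ [p + <-].
elim: p s fh => [|x p IH] s fh.
  by move=> _; rewrite /variation_on big_geq// esum_ge0.
move=> spt; have xpt := itv_partition_cons spt.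
have [/= /andP[sx _] _] := spt; have xt := itv_partition_le xpt.
rewrite variation_on_cons (esum_itv_split s x t (ltW sx) xt) EFinD leeD//.
  exact: fh.
by apply: IH => // u v xu; apply: fh; rewrite (le_trans (ltW sx)).
Qed.

End half_open_sums.

(** * Finite sums of jumps *)

Section jump_sums.
Context {R : realType} {X : completeMetricType R} (f : R -> X).
Implicit Types s r t : R.

Lemma jump_cvg t : f x @[x --> t^'+] --> right_limit f t ->
  mdist (f t) (f x) @[x --> t^'+] --> jump f t.
Proof.
move=> fcvg; apply/cvgrPdist_lt => e e0.
have /(_ _ _ e0) := metricType_numDomainType.cvgr_dist_lt fcvg.
apply: filterS => x; apply: le_lt_trans; rewrite /jump ler_norml.
have := metric_triangle (f t) (right_limit f t) (f x).
have := metric_triangle (right_limit f t) (f x) (f t).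
rewrite (metric_sym (f t) (right_limit f t)) (metric_sym (f x) (f t)).
by move=> *; apply/andP; split; lra.
Qed.

(** Induction on the increasing list: the first jump, at [x], is the limit of the distances from
    [f x] to [f r] as [r] decreases to [x], and the later points lie in [[r, t[] once [r] is close
    to [x]. *)
Lemma sum_jump_le_variation s t (l : seq R) :
  (forall x, x \in `[s, t[ -> f y @[y --> x^'+] --> right_limit f x) ->
  s <= t -> sorted <%R l -> {subset l <= `[s, t[} ->
  ((\sum_(x <- l) jump f x)%:E <= metric_variation f s t)%E.
Proof.
elim: l s => [|x l IH] s flim st; first by rewrite big_nil metric_variation_ge0.
move=> /= xl lst; have := lst x (mem_head _ _).
rewrite in_itv/= => /andP[sx xt].
have xl_near : \forall r \near x^'+, forall y, y \in l -> r <= y.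
  case: l xl {IH lst} => [_|z l /= /andP[xz zl]]; first exact: nearW.
  near=> r => y; rewrite inE => /predU1P[->|/(allP (order_path_min lt_trans zl))].
    by near: r; exact: nbhs_right_ltW.
  move=> /ltW; apply: le_trans.
  by near: r; exact: nbhs_right_ltW.
apply: (le_trans _ (le_metric_variation f s x t sx)).
rewrite big_cons EFinD -leeBrDr//.
have fx_cvg : (mdist (f x) (f r))%:E @[r --> x^'+] --> (jump f x)%:E.
  apply: cvg_EFin; first exact: nearW.
  by apply: jump_cvg; apply: flim; rewrite in_itv/= sx.
apply: (cvge_to_le fx_cvg); near=> r; rewrite leeBrDr//.
have xr : x < r by near: r; exact: nbhs_right_gt.
have rt : r < t by near: r; exact: nbhs_right_lt.
apply: (le_trans _ (mdist_metric_variation f x r t xr)); rewrite leeD2l//.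
apply: IH; [|exact: ltW|exact: path_sorted xl|].
  move=> y; rewrite in_itv/= => /andP[ry yt]; apply: flim.
  by rewrite in_itv/= yt (le_trans sx)// (le_trans (ltW xr)).
move=> y yl; have := lst y; rewrite inE yl orbT => /(_ isT).
rewrite !in_itv/= => /andP[_ ->]; rewrite andbT.
by move: y yl; near: r.
Unshelve. all: end_near. Qed.

End jump_sums.

(** * Functions that move little where [g] has small increments *)

Section superlinear_modulus.
Context {R : realType} {X : completeMetricType R}.
Variables (a b : R) (g : R -> R) (f : R -> X).
Hypothesis g_left : forall t, t \in `]a, b] -> g x @[x --> t^'-] --> g t.
Hypothesis g_ndecr : {in `[a, b] &, {homo g : s t / s <= t}}.
(** This is the form in which the exponent above 1 enters; [delta] is uniform in the position of [s]
    and [t]. *)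
Hypothesis f_small : forall eps, 0 < eps -> exists2 delta, 0 < delta &
  forall s t, a <= s -> s < t -> t <= b -> g t - g s < delta ->
    mdist (f s) (f t) <= eps * (g t - g s).
Implicit Types s t r u : R.

Let g_le s t : a <= s -> s <= t -> t <= b -> g s <= g t.
Proof.
move=> s1 st tb; apply: g_ndecr => //; rewrite in_itv/=.
  by rewrite s1 (le_trans st).
by rewrite (le_trans s1).
Qed.

(** Since [g] may jump at [u], increments start at points [r' > u]: [g r] tends to the infimum of
    [g] over []u, b]], which is a lower bound of [g r']. *)
Lemma small_right_increments u eps : a <= u < b -> 0 < eps ->
  \forall r \near u^'+, forall r', u < r' -> r' <= r -> g r - g r' < eps.
Proof.
move=> /andP[au ub] eps0.
have lbg : lbound (g @` `]u, b]) (g u).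
  move=> _ [x /= + <-]; rewrite in_itv/= => /andP[ux xb].
  by rewrite g_le// ltW.
have : g x @[x --> u^'+] --> inf (g @` `]u, b]).
  apply: nondecreasing_at_right_cvgr; first by rewrite bnd_simp.
    move=> x y; rewrite !in_itv/= => /andP[ux xb] /andP[uy yb] xy.
    by rewrite g_le// (le_trans au)// ltW.
  by exists (g u).
move=> /cvgrPdist_lt/(_ _ eps0) near_inf; near=> r => r' ur' r'r.
have rb : r <= b by near: r; exact: nbhs_right_ltW.
have : inf (g @` `]u, b]) <= g r'.
  apply: ge_inf; first by exists (g u).
  by exists r' => //=; rewrite in_itv/= ur' (le_trans r'r).
have : `|inf (g @` `]u, b]) - g r| < eps by near: r.
by rewrite ltr_norml => /andP[] *; lra.
Unshelve. all: end_near. Qed.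

Lemma right_limit_cvg u : a <= u < b ->
  f x @[x --> u^'+] --> right_limit f u.
Proof.
move=> aub; have /andP[au ub] := aub.
apply/cauchy_cvgP; apply: cauchy_exP => e e0.
have [delta delta0 fdelta] := f_small _ ltr01.
(* Increments below [delta] allow the modulus with factor 1; being below [e] as well, they keep
   [f x] in the ball of radius [e] around [f r]. *)
have de0 : 0 < Num.min delta e by rewrite lt_min delta0.
near u^'+ => r; exists (f r).
have ur : u < r by near: r; exact: nbhs_right_gt.
have rb : r <= b by near: r; exact: nbhs_right_ltW.
have gr : forall r', u < r' -> r' <= r -> g r - g r' < Num.min delta e.
  by near: r; exact: small_right_increments.
rewrite /= ballEmdist; near=> x.
have ux : u < x by near: x; exact: nbhs_right_gt.
have xr : x < r by near: x; exact: nbhs_right_lt.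
have := gr _ ux (ltW xr); rewrite lt_min => /andP[gdelta ge].
rewrite /= metric_sym (le_lt_trans _ ge)// -[leRHS]mul1r.
by apply: fdelta => //; rewrite (le_trans au)// ltW.
Unshelve. all: end_near. Qed.

(** Go from [f u] to [f r] through [f x] and let [x] decrease to [u]: the first leg tends to the
    jump, and the modulus bounds the second. *)
Lemma mdist_le_jump u eps : a <= u < b -> 0 < eps ->
  \forall r \near u^'+, mdist (f u) (f r) <= jump f u + eps * (g r - g u).
Proof.
move=> aub eps0; have /andP[au ub] := aub.
have [delta delta0 fdelta] := f_small _ eps0.
near=> r.
have ur : u < r by near: r; exact: nbhs_right_gt.
have rb : r <= b by near: r; exact: nbhs_right_ltW.
have gr : forall r', u < r' -> r' <= r -> g r - g r' < delta.
  by near: r; exact: small_right_increments.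
rewrite -lerBlDr; apply: (cvgr_to_ge (jump_cvg f _ (right_limit_cvg u aub))).
near=> x.
have ux : u < x by near: x; exact: nbhs_right_gt.
have xr : x < r by near: x; exact: nbhs_right_lt.
have ax : a <= x by rewrite (le_trans au)// ltW.
have := fdelta _ _ ax xr rb (gr _ ux (ltW xr)).
have : eps * (g r - g x) <= eps * (g r - g u).
  by rewrite ler_pM2l// lerB// g_le// ltW// (lt_le_trans xr).
have := metric_triangle (f u) (f x) (f r).
lra.
Unshelve. all: end_near. Qed.

(* The set [A] of good endpoints contains its supremum by left continuity of
   [g], and can be extended to the right of any of its points below [t] by
   [mdist_le_jump]. *)
Lemma mdist_le_sum_jump_eps s t eps : a <= s -> s < t -> t <= b -> 0 < eps ->
  ((mdist (f s) (f t))%:E <=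
   \esum_(x in `[s, t[) (jump f x)%:E + (eps * (g t - g s))%:E)%E.
Proof.
move=> a_s st tb eps0.
have jump_ge0 x : (0 <= (jump f x)%:E)%E by rewrite lee_fin mdist_ge0.
pose S u := (\esum_(x in `[s, u[) (jump f x)%:E)%E.
pose P u := ((mdist (f s) (f u))%:E <= S u + (eps * (g u - g s))%:E)%E.
(* The constant [c] is the share paid by the jumps in [[u, r[]: 0 when the supremum is reached from
   the left, [jump f w] when it is left to the right. *)
have step u r c : s <= u -> u <= r -> P u -> (S u + c%:E <= S r)%E ->
    mdist (f u) (f r) <= c + eps * (g r - g u) -> P r.
  move=> su ur Pu Sur dur; rewrite /P.
  apply: (@le_trans _ _ ((mdist (f s) (f u))%:E + (mdist (f u) (f r))%:E)%E).
    by rewrite -EFinD lee_fin metric_triangle.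
  apply: (@le_trans _ _ (S u + (eps * (g u - g s))%:E +
                         (c + eps * (g r - g u))%:E)%E).
    by rewrite leeD// lee_fin.
  rewrite -addeA -EFinD.
  have -> : eps * (g u - g s) + (c + eps * (g r - g u)) =
    c + eps * (g r - g s) by lra.
  by rewrite EFinD addeA leeD2r.
have Ps : P s.
  by rewrite /P metric_structure.mdistxx subrr mulr0 adde0 esum_ge0.
pose A := [set u | s <= u <= t /\ P u].
have A_s : A s by split => //; rewrite lexx ltW.
have ubA : ubound A t by move=> u [/andP[]].
have supA : has_sup A by split; [exists s|exists t].
set w := sup A.
have sw : s <= w by apply: ub_le_sup => //; exists t.
have wt : w <= t by apply: ge_sup => //; exists s.
have Pw : P w.
  move: sw; rewrite le_eqVlt => /predU1P[<-//|sw].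
  have [delta delta0 fdelta] := f_small _ eps0.
  have : g x @[x --> w^'-] --> g w.
    by apply: g_left; rewrite in_itv/= (le_lt_trans a_s)// (le_trans wt).
  move=> /cvgrPdist_lt/(_ _ delta0) near_gw.
  near w^'- => v.
  have vw : v < w by near: v; exact: nbhs_left_lt.
  have sv : s <= v by near: v; exact: nbhs_left_ge.
  have gvw : g w - g v < delta.
    apply: le_lt_trans (ler_norm _) _.
    by near: v.
  have wv0 : 0 < w - v by rewrite subr_gt0.
  (* A point [u] of [A] beyond [v] satisfies [g w - g u <= g w - g v < delta] by monotonicity. *)
  have [u Au] := sup_adherent wv0 supA; rewrite subKr => vu.
  have uw : u <= w by apply: ub_le_sup => //; exists t.
  move: uw; rewrite le_eqVlt => /predU1P[<-|uw]; first by case: Au.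
  have [/andP[su ut] Pu] := Au.
  apply: (step u w 0) => //; first exact: ltW.
    by rewrite adde0; apply: le_esum_itv => //; exact: ltW.
  rewrite add0r; apply: fdelta => //; [exact: le_trans su|exact: le_trans tb|].
  apply: le_lt_trans gvw; rewrite lerB// g_le//.
  - exact: le_trans sv.
  - exact: ltW.
  - exact: (le_trans ut).
move: wt; rewrite le_eqVlt => /predU1P[<-//|wt].
have aw : a <= w by rewrite (le_trans a_s).
have wb : w < b by rewrite (lt_le_trans wt).
suff : exists r, [/\ w < r, r <= t & P r].
  move=> [r [wr rt Pr]]; suff : r <= w by rewrite leNgt wr.
  by apply: ub_le_sup; [exists t|split => //; rewrite rt (le_trans sw)// ltW].
near w^'+ => r; exists r.
have wr : w < r by near: r; exact: nbhs_right_gt.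
split => //; first by near: r; exact: nbhs_right_ltW.
apply: (step w r (jump f w)) => //.
  rewrite /S (esum_itv_split _ jump_ge0 s w r sw (ltW wr)) leeD2l//.
  exact: (esum_itv_ge (fun x => (jump f x)%:E)).
by near: r; apply: mdist_le_jump => //; rewrite aw.
Unshelve. all: end_near. Qed.

Lemma mdist_le_sum_jump s t : a <= s -> s < t -> t <= b ->
  ((mdist (f s) (f t))%:E <= \esum_(x in `[s, t[) (jump f x)%:E)%E.
Proof.
move=> a_s st tb; apply/lee_addgt0Pr => e e0.
have gst : 0 <= g t - g s by rewrite subr_ge0 g_le// ltW.
(* Adding 1 keeps the divisor positive when [g t = g s]. *)
have d0 : 0 < g t - g s + 1 by lra.
apply: le_trans (mdist_le_sum_jump_eps _ _ _ a_s st tb (divr_gt0 e0 d0)) _.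
by rewrite leeD2l// lee_fin mulrAC ler_pdivrMr// ler_pM2l// lerDl.
Qed.

Lemma variation_eq_sum_jump s t : a <= s -> s < t -> t <= b ->
  metric_variation f s t = (\esum_(x in `[s, t[) (jump f x)%:E)%E.
Proof.
move=> a_s st tb; apply/eqP; rewrite eq_le; apply/andP; split.
  apply: metric_variation_le_esum => [x|u v su uv vt].
    by rewrite lee_fin mdist_ge0.
  by apply: mdist_le_sum_jump => //; [exact: le_trans su|exact: le_trans tb].
apply: ge_ereal_sup => _ [B [finB Bst] <-].
rewrite fsbig_finite//= sumEFin.
set l := finmap.enum_fset _.
(* The finite set [B] is listed in increasing order, as the bound on finite sums of jumps
   requires. *)
rewrite -(perm_big _ (permEl (perm_sort <=%R l)))/=.
apply: sum_jump_le_variation.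
- move=> x; rewrite in_itv/= => /andP[sx xt]; apply: right_limit_cvg.
  by rewrite (le_trans a_s)// (lt_le_trans xt).
- exact: ltW.
- by rewrite sort_lt_sorted finmap.fset_uniq.
- by move=> x; rewrite mem_sort in_fset_set// inE => /Bst.
Qed.

End superlinear_modulus.

(** * Powers with exponent above 1, and the Hölder case *)

Lemma powR_superlinear {R : realType} (C alpha eps : R) :
  0 <= C -> 1 < alpha -> 0 < eps ->
  exists2 delta, 0 < delta &
    forall x, 0 <= x -> x < delta -> C * x `^ alpha <= eps * x.
Proof.
move=> C0 alpha1 eps0.
have C1 : 0 < C + 1 by lra.
have ec0 : 0 < eps / (C + 1) by rewrite divr_gt0.
have a1 : 0 < alpha - 1 by lra.
(* With [x ^ alpha] split as [x ^ (alpha - 1) * x], this [delta] makes the first factor at most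
   [eps / (C + 1)]; dividing by [C + 1] allows [C = 0]. *)
exists ((eps / (C + 1)) `^ (alpha - 1)^-1); first exact: powR_gt0.
move=> x; rewrite le_eqVlt => /predU1P[<-|x0] xd.
  by rewrite powR0 ?mulr0// gt_eqF//; lra.
have -> : alpha = (alpha - 1) + 1 by lra.
rewrite powRD; last by rewrite (gt_eqF x0) implybT.
rewrite (powRr1 (ltW x0)) mulrA ler_pM2r//.
have : x `^ (alpha - 1) <= eps / (C + 1).
  have -> : eps / (C + 1) = (eps / (C + 1)) `^ (alpha - 1)^-1 `^ (alpha - 1).
    by rewrite -powRrM (mulVf (lt0r_neq0 a1)) (powRr1 (ltW ec0)).
  apply: (ge0_ler_powR (ltW a1)); last exact: ltW.
    by rewrite nnegrE ltW.
  by rewrite nnegrE powR_ge0.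
rewrite ler_pdivlMr// mulrDr mulr1 mulrC => h.
by apply: le_trans h; rewrite lerDl powR_ge0.
Qed.

Theorem corollary9p5 (R : realType) (X : completeMetricType R)
  (a b : R) (ab : a <= b)
  (g : R -> R)
  (g_left : forall t, t \in `]a, b] -> g x @[x --> t^'-] --> g t)
  (g_ndecr : {in `[a, b] &, {homo g : s t / s <= t}})
  (alpha : R) (alpha_gt1 : 1 < alpha)
  (F : R -> set X)
  (F_compact : forall t, t \in `[a, b] -> nonempty_compacts (F t))
  (F_holder : is_holder a b g alpha F)
  (theta : R) (theta_I : theta \in `[a, b])
  (x_theta : X) (x_theta_F : F theta x_theta)
  (f : R -> X)
  (f_sel : forall t, t \in `[a, b] -> F t (f t))
  (f_theta : f theta = x_theta)
  (f_var : forall s t, a <= s -> s < t -> t <= b ->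
    [/\ ((mdist (f s) (f t))%:E <= hausdorff_variation F s t)%E,
        (hausdorff_variation F s t <=
          (holder_seminorm a b g alpha F * `|g t - g s| `^ alpha)%:E)%E &
        (metric_variation f s t <= hausdorff_variation F s t)%E]) :
  forall s t, a <= s -> s < t -> t <= b ->
    metric_variation f s t = \esum_(tau in `[s, t[) (jump f tau)%:E /\
    \esum_(tau in `[s, t[) (jump f tau)%:E =
      \esum_(tau in `[s, t[) (mdist (right_limit f tau) (f tau))%:E.
Proof.
move=> s t a_s st tb; split=> //.
(* What remains is the smallness of [f] relative to [g], obtained with the Hölder seminorm as
   [C]. *)
apply: (variation_eq_sum_jump a b g f) => // eps eps0.
have [C0 _] := (holder_seminorm_min F_holder).1.
have [delta delta0 gdelta] := powR_superlinear _ _ _ C0 alpha_gt1 eps0.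
exists delta => // u v au uv vb guv.
have [dH Hg _] := f_var u v au uv vb.
have gu : 0 <= g v - g u.
  rewrite subr_ge0; apply: g_ndecr; last exact: ltW.
    by rewrite in_itv/= au (le_trans (ltW uv)).
  by rewrite in_itv/= vb (le_trans au (ltW uv)).
have := le_trans dH Hg; rewrite lee_fin (ger0_norm gu) => /le_trans; apply.
exact: gdelta.
Qed.
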